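(* Every uncapacitated flow-based extension (or, equivalently, every $s$--$t$ path extension) of the traveling salesman polytope $P_{\mathrm{traveling\ salesman}}(K_n)$ of the complete graph $K_n$ has size $\Omega\left(\frac{2^{\frac{n}{4}}}{\sqrt{n}}\right)$. That is, there is an absolute constant $C>0$ such that for all sufficiently large integers $n$, every such extension has size at least $C\,\frac{2^{n/4}}{\sqrt{n}}$.
   Context: Traveling salesman polytope: a Hamiltonian cycle of an undirected graph $G=(V(G),E(G))$ is a connected subgraph $C$ of $G$ such that every vertex of $G$ is incident to exactly two edges of $C$. $P_{\mathrm{traveling\ salesman}}(G)=\operatorname{conv}\{\chi^{E(C)}\in\mathbb{R}^{E(G)} : C \text{ Hamiltonian cycle of } G\}$, where $E(C)$ is the edge set of $C$ and $\chi^{E(C)}$ is its incidence (0/1 characteristic) vector. Networks and flows: an uncapacitated network $N=(V,A)$ is a finite directed graph (parallel arcs allowed) with a source $s\in V$ and a sink $t\in V\setminus\{s\}$. For $v\in V$, $\delta^+(v)$ and $\delta^-(v)$ denote the sets of arcs leaving and entering $v$, and $\phi(B):=\sum_{a\in B}\phi_a$ for $\phi\in\mathbb{R}^A$, $B\subseteq A$. For a flow value $k>0$, the (uncapacitated) flow polyhedron is $$Q=\{\phi\in\mathbb{R}^A : \phi(\delta^+(v))-\phi(\delta^-(v))=0\ \forall v\in V\setminus\{s,t\},\ \phi(\delta^+(s))-\phi(\delta^-(s))=k,\ \phi\geqslant 0\}.$$ $Q$ is an uncapacitated flow-based extension of a polytope $P\subseteq\mathbb{R}^d$ if there is a linear map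 $\pi:\mathbb{R}^A\to\mathbb{R}^d$ with $\pi(Q)=P$. Its size is the number of arcs $|A|$ of the network. If $N$ is acyclic and $k=1$, then $Q$ is the convex hull of the characteristic vectors $\chi^\sigma\in\mathbb{R}^A$ of the directed $s$--$t$ paths $\sigma$ in $N$; in this case the extension is called an $s$--$t$ path extension. *)

(* Defs.v *)
From HB Require Import structures.
From mathcomp Require Import all_boot all_order all_algebra.
From mathcomp Require Import all_classical all_reals all_analysis.

Set Implicit Arguments.
Unset Strict Implicit.
Unset Printing Implicit Defensive.

Import Order.TTheory GRing.Theory Num.Theory.
Local Open Scope classical_set_scope.
Local Open Scope ring_scope.

Definition convex_hull (R : realType) (E : lmodType R) (X : set E) : set E :=
  smallest (fun A => convex_set (A : set (convex_lmodType E))) X.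
Arguments convex_hull {R E} X _.

Record sgraph := SGraph {
  vertex :> finType;
  edges : {set {set vertex}};
  edges_card2 : forall e, e \in edges -> #|e| = 2%N }.

Definition edge (G : sgraph) : finType := {e : {set G} | e \in edges G}.

Record subgraph (G : sgraph) := Subgraph {
  sub_vertices : {set G};
  sub_edges : {set {set G}};
  sub_edges_sub : sub_edges \subset edges G;
  sub_edges_ends : forall e, e \in sub_edges -> e \subset sub_vertices }.

(* Edges of C have both ends in C, so a path between vertices of C never
   leaves C; [set x; x] is a singleton and hence never an edge. *)
Definition connected_subgraph (G : sgraph) (C : subgraph G) : Prop :=
  (exists x, x \in sub_vertices C) /\
  forall x y, x \in sub_vertices C -> y \in sub_vertices C ->
    connect [rel u v | [set u; v]%SET \in sub_edges C] x y.

Definition hamiltonian_cycle (G : sgraph) (C : subgraph G) : Prop :=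
  connected_subgraph C /\
  forall v : G, #|[set e in sub_edges C | v \in e]%SET| = 2%N.

Definition edge_incidence (R : realType) (G : sgraph) (F : {set {set G}}) :
    {ffun edge G -> R} :=
  [ffun e : edge G => (val e \in F)%:R].

Definition tsp_polytope (R : realType) (G : sgraph) : set {ffun edge G -> R} :=
  convex_hull [set x | exists C : subgraph G,
                  hamiltonian_cycle C /\ x = edge_incidence R (sub_edges C)].
Arguments tsp_polytope R G _ : clear implicits.

Definition complete_edges (n : nat) : {set {set 'I_n}} :=
  [set e : {set 'I_n} | #|e| == 2%N]%SET.

Lemma complete_edges_card2 n e : e \in complete_edges n -> #|e| = 2%N.
Proof. by rewrite inE => /eqP. Qed.

Definition complete_graph (n : nat) : sgraph :=
  SGraph (@complete_edges_card2 n).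

Record network := Network {
  net_node : finType;
  net_arc : finType;
  arc_tail : net_arc -> net_node;
  arc_head : net_arc -> net_node;
  source : net_node;
  sink : net_node;
  sink_neq_source : sink != source }.

Definition net_size (N : network) : nat := #|net_arc N|.

Definition out_arcs (N : network) (v : net_node N) : {set net_arc N} :=
  [set a | arc_tail a == v]%SET.

Definition in_arcs (N : network) (v : net_node N) : {set net_arc N} :=
  [set a | arc_head a == v]%SET.

Definition flow_on (R : realType) (N : network) (phi : {ffun net_arc N -> R})
    (B : {set net_arc N}) : R :=
  \sum_(a in B) phi a.

Definition excess (R : realType) (N : network) (phi : {ffun net_arc N -> R})
    (v : net_node N) : R :=
  flow_on phi (out_arcs v) - flow_on phi (in_arcs v).

Definition flow_polyhedron (R : realType) (N : network) (k : R) :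
    set {ffun net_arc N -> R} :=
  [set phi | [/\ forall v, v != source N -> v != sink N -> excess phi v = 0,
                 excess phi (source N) = k
               & forall a, 0 <= phi a]].
Arguments flow_polyhedron {R} N k _.

Definition flow_based_extension (R : realType) (N : network) (k : R)
    (E : lmodType R) (P : set E) : Prop :=
  0 < k /\
  exists f : {linear {ffun net_arc N -> R} -> E}, f @` flow_polyhedron N k = P.

Definition acyclic (N : network) : Prop :=
  forall (v : net_node N) (p : seq (net_node N)),
    path [rel x y | [exists a, (arc_tail a == x) && (arc_head a == y)]] v p ->
    last v p = v -> p = [::].

Definition st_path_extension (R : realType) (N : network)
    (E : lmodType R) (P : set E) : Prop :=
  acyclic N /\ flow_based_extension N 1 P.

(* Main.v *)
(* Write the tour of K_n visiting l_i, b_(tau i), r_i, l_(i+1), ... for a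
   permutation tau of m = 4 * (n %/ 12) items b_j; the edges r_i l_(i+1) and
   those through the remaining vertices lie in every such tour (the "frame").
   Give each arc the image of its unit flow as a vector of edge costs.  Every
   s-t walk costs a point of P, and since a 0/1 point of P is extreme, every
   tour is the cost of some s-t walk.  Two walks with full frame through a
   common node can exchange their tails.  Hence at a node v the degree of a
   vertex in the part of the cost collected before v is the same for all such
   walks, and so is whether some edge at that vertex has been "started", i.e.
   costs more than on the cheapest prefix reaching v.  Started edges belong to
   the tour and not to the frame, so v determines the set I_v of positions i
   with a started edge and its image tau(I_v), while an arc (v,w) determines tau
   on I_w \ I_v.  The sets I_v grow from empty to everything along a walk; for
   each h some arc has #|I_v| <= h <= #|I_w|, and then it determines tau(J) for
   some J of size h.  So an arc serves at most m!/'C(m,h) permutations, there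
   are at least 'C(m,h) arcs, and summing over h yields 2^m <= (m+1) |A|. *)

Require Import Defs.
From mathcomp Require Import all_boot all_order all_fingroup all_algebra.
From mathcomp Require Import all_classical all_reals all_analysis.
From mathcomp Require Import zify ring lra.

Set Implicit Arguments.
Unset Strict Implicit.
Unset Printing Implicit Defensive.

Import Order.TTheory GRing.Theory Num.Theory.
Local Open Scope ring_scope.

(** * Directed walks in a network and their costs *)

Section Walks.
Variable N : network.
Implicit Types (x y z : net_node N) (p q : seq (net_arc N)).

Fixpoint walk x p y : bool :=
  if p is a :: p' then (arc_tail a == x) && walk (arc_head a) p' y else x == y.

Lemma walk_cat x p z q y : walk x p z -> walk z q y -> walk x (p ++ q) y.
Proof.
by elim: p x => [x /eqP->//|a p IH x /= /andP[-> /IH]]; apply.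
Qed.

Lemma walk_cat_cons x p a q y :
  walk x (p ++ a :: q) y = walk x p (arc_tail a) && walk (arc_head a) q y.
Proof.
elim: p x => [x|b p IH x] /=; first by rewrite eq_sym.
by rewrite IH andbA.
Qed.

Lemma walk_rcons x p a : walk x (rcons p a) (arc_head a) = walk x p (arc_tail a).
Proof. by rewrite -cats1 walk_cat_cons /= eqxx andbT. Qed.

(** Take the first arc whose head reaches level [h]: its tail is still at level at most [h]. *)
Lemma walk_crossing (g : net_node N -> nat) (h : nat) x p y :
  walk x p y -> x != y -> (g x <= h)%N -> (h <= g y)%N ->
  exists p1 a p2, [/\ p = p1 ++ a :: p2, (g (arc_tail a) <= h)%N
                    & (h <= g (arc_head a))%N].
Proof.
elim: p x => [x /= ->//|a p IH x /= /andP[/eqP ta wp] _ gx gy].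
have [hg|/ltnW gh] := leqP h (g (arc_head a)).
  by exists [::], a, p; rewrite ta.
have [e|ne] := eqVneq (arc_head a) y.
  by exists [::], a, p; rewrite ta e.
have [p1 [b [p2 [-> ? ?]]]] := IH _ wp ne gh gy.
by exists (a :: p1), b, p2.
Qed.

End Walks.

Section Cost.
Variables (R : realType) (N : network) (E : finType).
Variable c : net_arc N -> E -> R.

Definition cost (p : seq (net_arc N)) (e : E) : R := \sum_(a <- p) c a e.

Lemma cost_cat p q e : cost (p ++ q) e = cost p e + cost q e.
Proof. exact: big_cat. Qed.

Lemma cost_nil e : cost [::] e = 0.
Proof. exact: big_nil. Qed.

End Cost.

(** * Exchanging tails of walks through a common node *)

Section Routes.
Variables (R : realType) (N : network) (E V : finType).
Variables (c : net_arc N -> E -> R) (inc : V -> pred E) (deg : V -> R).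
Variable F : pred E.
Local Notation s := (source N).
Local Notation t := (sink N).
Local Notation cost := (cost c).
Hypothesis cost01 : forall p e, walk s p t -> 0 <= cost p e <= 1.
Hypothesis cost_deg : forall p u, walk s p t -> \sum_(e | inc u e) cost p e = deg u.
Implicit Types (p q : seq (net_arc N)) (v : net_node N) (e : E).

Definition route p v q : Prop :=
  [/\ walk s p v, walk v q t & forall e, F e -> cost (p ++ q) e = 1].

Lemma route_walk p v q : route p v q -> walk s (p ++ q) t.
Proof. by case=> wp wq _; exact: walk_cat wp wq. Qed.

(** On a frame edge the crossed walks [p ++ q'] and [p' ++ q] together cost 2, as the given ones do,
    and each costs at most 1. *)
Lemma route_cross p v q p' q' : route p v q -> route p' v q' -> route p v q'.
Proof.
move=> [wp wq Fpq] [wp' wq' Fpq']; split=> // e Fe.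
have := Fpq e Fe; have := Fpq' e Fe; rewrite !cost_cat.
have := cost01 e (walk_cat wp wq'); have := cost01 e (walk_cat wp' wq).
rewrite !cost_cat; lra.
Qed.

(* Positive reduced cost for the shortest-path potential of [e], phrased
   without forming the infimum. *)
Definition started v p e : Prop :=
  exists p' q', route p' v q' /\ cost p' e < cost p e.

Lemma not_started v p e p' q' :
  ~ started v p e -> route p' v q' -> cost p e <= cost p' e.
Proof. by move=> ns r; rewrite leNgt; apply/negP => l; apply: ns; exists p', q'. Qed.

Lemma started_gt0 p v q e : route p v q -> started v p e -> 0 < cost (p ++ q) e.
Proof.
move=> r [p' [q' [r' lt]]].
have := cost01 e (route_walk (route_cross r' r)); rewrite !cost_cat; lra.
Qed.

Lemma started_notF p v q e : route p v q -> started v p e -> ~~ F e.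
Proof.
move=> r [p' [q' [r' lt]]]; apply/negP => Fe.
have [_ _ /(_ e Fe)] := r; have [_ _ /(_ e Fe)] := route_cross r' r.
rewrite !cost_cat; lra.
Qed.

(** [p ++ q] and [p' ++ q] have the same degree at [u], so [p] and [p'] carry equal parts of it. If
    [p'] had started nothing at [u], it would be cheapest on every edge there, and strictly cheaper
    than [p] on [e]. *)
Lemma started_star p v q p' q' u e : route p v q -> route p' v q' ->
  inc u e -> started v p e -> exists2 e', inc u e' & started v p' e'.
Proof.
move=> r r' ue [p0 [q0 [r0 lt]]]; apply: contrapT => no.
have le e' p1 q1 : inc u e' -> route p1 v q1 -> cost p' e' <= cost p1 e'.
  by move=> ue' r1; apply: not_started r1 => st; apply: no; exists e'.
have D : \sum_(e' | inc u e') cost p' e' = \sum_(e' | inc u e') cost p e'.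
  have := cost_deg u (route_walk (route_cross r' r)).
  rewrite -(cost_deg u (route_walk r)).
  under eq_bigr do rewrite cost_cat.
  under [in RHS]eq_bigr do rewrite cost_cat.
  by rewrite !big_split /=; apply: addIr.
have /negP[] : ~~ (\sum_(e' | inc u e') cost p' e' < \sum_(e' | inc u e') cost p e').
  by rewrite D ltxx.
rewrite (bigD1 e) //= [ltRHS](bigD1 e) //=; apply: ltr_leD.
  exact: le_lt_trans (le _ _ _ ue r0) lt.
by apply: ler_sum => e' /andP[ue' _]; exact: le r.
Qed.

Lemma route_rcons p a q :
  route p (arc_tail a) (a :: q) <-> route (rcons p a) (arc_head a) q.
Proof.
rewrite /route walk_rcons cat_rcons /= eqxx; split=> -[]; by split.
Qed.

Lemma cost_rcons p a e : cost (rcons p a) e = cost p e + c a e.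
Proof. by rewrite -cats1 cost_cat [X in _ + X]big_seq1. Qed.


Lemma started_mono p a q e : route p (arc_tail a) (a :: q) ->
  started (arc_tail a) p e -> started (arc_head a) (rcons p a) e.
Proof.
move=> r [p' [q' [r' lt]]]; exists (rcons p' a), q; split.
  exact/route_rcons/(route_cross r' r).
by rewrite !cost_rcons ltrD2r.
Qed.

(** As [e] is not started on [p], the prefix [p'] costs at least as much on [e] before the arc,
    hence also after it. *)
Lemma started_by_arc p p' a q q' e :
  route p (arc_tail a) (a :: q) -> route p' (arc_tail a) (a :: q') ->
  ~ started (arc_tail a) p e -> started (arc_head a) (rcons p a) e ->
  started (arc_head a) (rcons p' a) e.
Proof.
move=> r r' ns [p0 [q0 [r0 lt]]]; exists p0, q0; split=> //.
by apply: lt_le_trans lt _; rewrite !cost_rcons lerD2r; exact: not_started r'.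
Qed.

Lemma route_source_iter p q n :
  route p s q -> exists2 p', route p' s q & forall e, cost p' e = n%:R * cost p e.
Proof.
move=> r; elim: n => [|n [p' r' cE]].
  exists [::]; last by move=> e; rewrite mul0r cost_nil.
  have [wp wq _] := r; split=> //= e Fe.
  (* Traversing the closed walk [p] twice keeps the frame cost at 1, so [p] costs 0 on the frame and
     [q] alone has full frame. *)
  suff: route p s (p ++ q).
    case=> _ _ /(_ e Fe); have [_ _ /(_ e Fe)] := r.
    rewrite !cost_cat; lra.
  have r0 : route [::] s (p ++ q).
    by have [_ _ F1] := r; split=> //=; exact: route_walk r.
  exact: route_cross r r0.
exists (p ++ p'); last first.
  by move=> e; rewrite cost_cat cE -natr1 mulrDl mul1r addrC.
have r0 : route [::] s (p' ++ q).
  by have [_ _ F1] := r'; split=> //=; exact: route_walk r'.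
have [wp wq F1] := route_cross r r0.
have [wp' wq' _] := r'.
by split=> //; [exact: walk_cat wp wp'|move=> e Fe; rewrite -catA F1].
Qed.

(** A prefix returning to the source can be repeated at will; a nonzero cost would then leave the
    unit interval. *)
Lemma route_source p q e : route p s q -> cost p e = 0.
Proof.
move=> r; apply/eqP/negP => /negP c0.
(* So many rounds that their cost is, in absolute value, too large for [cost q e] to bring the sum
   back into the unit interval. *)
pose n := Num.bound ((1 + `|cost q e|) / `|cost p e|).
have [p' r' cE] := route_source_iter n r.
have := cost01 e (route_walk r'); rewrite cost_cat cE => bnd.
have : (1 + `|cost q e|) / `|cost p e| < n%:R.
  by apply: archi_boundP; rewrite divr_ge0 // addr_ge0.
rewrite ltr_pdivrMr ?normr_gt0 // -[n%:R]normr_nat -normrM.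
suff : `|n%:R * cost p e| <= 1 + `|cost q e| by rewrite leNgt => /negP.
have -> : n%:R * cost p e = (n%:R * cost p e + cost q e) - cost q e by rewrite addrK.
apply: le_trans (ler_normB _ _) _; rewrite lerD2r ger0_norm; lra.
Qed.

Lemma not_started_source p q e : route p s q -> ~ started s p e.
Proof.
move=> r [p' [q' [r' lt]]].
by move: lt; rewrite (route_source e r) (route_source e r') ltxx.
Qed.

End Routes.

Lemma subset_between (T : finType) (A B : {set T}) h : A \subset B ->
  (#|A| <= h)%N -> (h <= #|B|)%N ->
  exists J : {set T}, [/\ A \subset J, J \subset B & #|J| = h].
Proof.
move=> AB Ah hB; move: {2}(h - #|A|)%N (erefl (h - #|A|)%N) => k.
elim: k A AB Ah => [|k IH] A AB Ah hk.
  by exists A; split=> //; apply/eqP; rewrite eqn_leq Ah -subn_eq0 hk.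
have /fintype.properP[_ [x xB xA]] : A \proper B.
  rewrite finset.properEcard AB /=; by apply: leq_trans hB; rewrite -subn_gt0 hk.
have [| | |J [sJ JB cJ]] := IH (x |: A)%SET.
- by rewrite finset.subUset AB finset.sub1set xB.
- by rewrite cardsU1 xA add1n -subn_gt0 hk.
- by rewrite cardsU1 xA add1n subnS hk.
by exists J; split=> //; apply: fintype.subset_trans sJ; exact: finset.subsetUr.
Qed.

(** * Tours indexed by permutations, and what nodes and arcs reveal of them *)

Section PermutationFamily.
Variables (R : realType) (N : network) (E V : finType).
Variables (c : net_arc N -> E -> R) (inc : V -> pred E) (deg : V -> R).
Variable F : pred E.
Local Notation s := (source N).
Local Notation t := (sink N).
Local Notation cost := (cost c).
Local Notation route := (route c F).
Local Notation started := (started c F).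
Hypothesis cost01 : forall p e, walk s p t -> 0 <= cost p e <= 1.
Hypothesis cost_deg : forall p u, walk s p t -> \sum_(e | inc u e) cost p e = deg u.

Variables (m : nat) (side : bool -> 'I_m -> V) (item : 'I_m -> V).
Variable join : bool -> 'I_m -> 'I_m -> E.
Hypothesis side_inj : forall b b' i i', side b i = side b' i' -> i = i'.
Hypothesis item_inj : injective item.
Hypothesis side_item : forall b i j, side b i != item j.
Hypothesis inc_join : forall u b i j,
  inc u (join b i j) = (u == side b i) || (u == item j).
Hypothesis joinF : forall b i j, ~~ F (join b i j).

Definition tour (tau : {perm 'I_m}) : pred E :=
  fun e => F e || [exists b, exists i, e == join b i (tau i)].

Hypothesis tour_walk : forall tau, exists2 p, walk s p t &
  forall e, cost p e = (tour tau e)%:R.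

Lemma join_inj b i j b' i' j' : join b i j = join b' i' j' -> i = i' /\ j = j'.
Proof.
move=> eJ; split.
  have : inc (side b i) (join b' i' j') by rewrite -eJ inc_join eqxx.
  by rewrite inc_join (negbTE (side_item _ _ _)) orbF => /eqP/side_inj.
have : inc (item j) (join b' i' j') by rewrite -eJ inc_join eqxx orbT.
by rewrite inc_join eq_sym (negbTE (side_item _ _ _)) => /eqP/item_inj.
Qed.

Lemma tour_join tau b i j : tour tau (join b i j) -> tau i = j.
Proof.
by rewrite /tour (negbTE (joinF _ _ _)) => /existsP[b' /existsP[i' /eqP/join_inj[-> ->]]].
Qed.

Definition tour_route tau p v q : Prop :=
  route p v q /\ forall e, cost (p ++ q) e = (tour tau e)%:R.

Lemma tour_route_of tau p v q : walk s p v -> walk v q t ->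
  (forall e, cost (p ++ q) e = (tour tau e)%:R) -> tour_route tau p v q.
Proof. by move=> wp wq cE; split=> //; split=> // e Fe; rewrite cE /tour Fe. Qed.

Lemma started_join tau p v q e : tour_route tau p v q -> started v p e ->
  exists b i, e = join b i (tau i).
Proof.
move=> [r cE] st; have := started_gt0 cost01 r st.
rewrite cE ltr0n lt0b /tour (negbTE (started_notF cost01 r st)) /=.
by move=> /existsP[b /existsP[i /eqP->]]; exists b, i.
Qed.

(** Quantifying over all routes makes this a function of the node alone; by [positionsP] any one
    tour through the node computes it. *)
Definition positions v : {set 'I_m} :=
  [set i | `[< exists p q, route p v q /\
               exists b e, inc (side b i) e /\ started v p e >]].

(** By [started_star], an edge started at a side of [i] on some route forces one on [p] at the same
    vertex; being a tour edge off the frame, it joins [i] to [tau i]. *)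
Lemma positionsP tau p v q i : tour_route tau p v q ->
  reflect (exists b, started v p (join b i (tau i))) (i \in positions v).
Proof.
move=> rt; have [r cE] := rt; rewrite inE. apply: (iffP (asboolP _)); last first.
  by move=> [b st]; exists p, q; split=> //; exists b, (join b i (tau i));
     rewrite inc_join eqxx.
move=> [p' [q' [r' [b [e [ie st]]]]]].
have [e' ie' st'] := started_star cost01 cost_deg r' r ie st.
have [b' [i' e'E]] := started_join rt st'.
move: ie'; rewrite e'E inc_join (negbTE (side_item _ _ _)) orbF => /eqP/side_inj ii.
by exists b'; rewrite ii -e'E.
Qed.

(** The same transfer at the vertex of the item [tau i] yields a position where [tau'] puts that
    item. One inclusion suffices, as both images have the size of [positions v]. *)
Lemma imset_positions tau tau' p v q p' q' :
  tour_route tau p v q -> tour_route tau' p' v q' ->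
  tau @: positions v = tau' @: positions v.
Proof.
move=> rt rt'; apply/eqP; rewrite eqEcard !card_imset ?leqnn ?andbT; try exact: perm_inj.
apply/fintype.subsetP => _ /imsetP[i /(positionsP _ rt)[b st] ->].
have [[r _] [r' _]] := (rt, rt').
have ie : inc (item (tau i)) (join b i (tau i)) by rewrite inc_join eqxx orbT.
have [e ie' st'] := started_star cost01 cost_deg r r' ie st.
have [b' [i' eE]] := started_join rt' st'.
apply/imsetP; exists i'; first by apply/(positionsP _ rt'); exists b'; rewrite -eE.
by move: ie'; rewrite eE inc_join eq_sym (negbTE (side_item _ _ _)) => /eqP/item_inj.
Qed.

Lemma positions_source : positions s = finset.set0.
Proof.
apply/setP => i; rewrite finset.in_set0 [LHS]inE; apply/negP.
move=> /asboolP[p [q [r [b [e [_ st]]]]]].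
exact: not_started_source cost01 _ _ _ r st.
Qed.

Lemma positions_sink : (1 < m)%N -> positions t = [set: 'I_m].
Proof.
move=> m1; apply/setP => i; rewrite [RHS]finset.in_setT.
have wt : walk t [::] t by rewrite /= eqxx.
have full tau : exists p, tour_route tau p t [::].
  have [p wp cE] := tour_walk tau; exists p.
  by apply: tour_route_of => // e; rewrite cats0.
have [p rt] := full 1%g.
apply/(positionsP _ rt); exists true.
(* The tour that swaps items [i] and [j] avoids the edge [join true i i], so at the sink the
   identity tour has started this edge. *)
have [j ji] : exists j, j != i.
  have [e|] := eqVneq i (Ordinal m1); last by rewrite eq_sym; exists (Ordinal m1).
  by exists (Ordinal (ltnW m1)); rewrite e.
have [p' rt'] := full (tperm i j).
exists p', [::]; split; first by case: rt'.
have [[_ cE] [_ cE']] := (rt, rt'); move: (cE) (cE'); rewrite !cats0 => -> ->.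
rewrite ltr_nat; case: (boolP (tour (tperm i j) _)) => [/tour_join|_].
  by rewrite perm1 tpermL => ij; rewrite ij eqxx in ji.
suff -> : tour 1%g (join true i (fun_of_perm 1%g i)) by [].
by apply/orP; right; apply/existsP; exists true; apply/existsP; exists i.
Qed.

Definition splits (h : nat) (tau : {perm 'I_m}) (a : net_arc N) : Prop :=
  exists p q, [/\ tour_route tau p (arc_tail a) (a :: q),
    (#|positions (arc_tail a)| <= h)%N & (h <= #|positions (arc_head a)|)%N].

Lemma splits_exists h tau : (1 < m)%N -> (h <= m)%N -> exists a, splits h tau a.
Proof.
move=> m1 hm; have [p wp cE] := tour_walk tau.
have [|||p1 [a [p2 [pE g1 g2]]]] :=
  walk_crossing (g := fun v => #|positions v|) (h := h) wp.
- by rewrite eq_sym sink_neq_source.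
- by rewrite positions_source cards0.
- by rewrite positions_sink // cardsT card_ord.
exists a, p1, p2; split=> //; move: wp cE; rewrite pE walk_cat_cons => /andP[w1 w2] cE.
by apply: tour_route_of => //=; rewrite eqxx.
Qed.

Lemma tour_route_rcons tau p a q : tour_route tau p (arc_tail a) (a :: q) ->
  tour_route tau (rcons p a) (arc_head a) q.
Proof. by move=> [/route_rcons r cE]; split=> // e; rewrite cat_rcons. Qed.

(** Choose [J] between the positions of the tail and those of the head. On the former the images
    agree as sets. At any other position of [J] the arc starts an edge of [tau0], and it does so on
    the route of [tau] too, so the tour of [tau] contains that edge. *)
Lemma splits_imset h tau0 a : splits h tau0 a -> exists2 J : {set 'I_m},
  #|J| = h & forall tau, splits h tau a -> tau @: J = tau0 @: J.
Proof.
move=> [p0 [q0 [rt0 lth hlt]]]; have rt0' := tour_route_rcons rt0.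
have sub : positions (arc_tail a) \subset positions (arc_head a).
  apply/fintype.subsetP => i /(positionsP _ rt0)[b st].
  by apply/(positionsP _ rt0'); exists b; have [r0 _] := rt0;
    apply: (started_mono cost01 r0 st).
have [J [sJ Js cJ]] : exists J : {set 'I_m},
  [/\ positions (arc_tail a) \subset J, J \subset positions (arc_head a) & #|J| = h].
  exact: subset_between.
exists J => // tau [p [q [rt _ _]]]; have rt' := tour_route_rcons rt.
have agree i : i \in J -> i \notin positions (arc_tail a) -> tau i = tau0 i.
  move=> iJ ni; have /(positionsP _ rt0')[b st] := fintype.subsetP Js i iJ.
  have ns : ~ started (arc_tail a) p0 (join b i (tau0 i)).
    by move=> st0; case/negP: ni; apply/(positionsP _ rt0); exists b.
  have [r0 _] := rt0; have [r _] := rt; have [r' _] := rt'.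
  have st' := started_by_arc r0 r ns st.
  have := started_gt0 cost01 r' st'; have [_ ->] := rt'.
  by rewrite ltr0n lt0b => /tour_join.
rewrite -(finset.setID J (positions (arc_tail a))) !imsetU.
rewrite (finset.setIidPr sJ) (imset_positions rt rt0); congr (_ :|: _).
by apply: eq_in_imset => i; rewrite finset.in_setD => /andP[ni iJ]; exact: agree.
Qed.

End PermutationFamily.

(** * Counting permutations by the image of a subset *)

Section PermCounting.
Variable T : finType.
Implicit Types A B J K : {set T}.

(** List each set followed by its complement; matching equal ranks in the two lists sends [A] onto
    [B]. *)
Lemma exists_perm_imset A B : #|A| = #|B| -> exists s : {perm T}, s @: A = B.
Proof.
move=> AB.
pose l (X : {set T}) := enum X ++ enum (~: X)%SET.
have lU X : uniq (l X).
  rewrite cat_uniq !enum_uniq andbT /=; apply/hasPn => x.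
  by rewrite !mem_enum finset.in_setC.
have lT X x : x \in l X by rewrite mem_cat !mem_enum finset.in_setC orbN.
have lS X : size (l X) = #|T| by rewrite size_cat -!cardE cardsC.
pose f x := nth x (l B) (index x (l A)).
have idx x : (index x (l A) < size (l B))%N by rewrite lS -(lS A) index_mem.
have f_inj : injective f.
  move=> x y; rewrite /f (set_nth_default y) // => /eqP.
  by rewrite nth_uniq // => /eqP/(congr1 (nth x (l A))); rewrite !nth_index.
exists (perm f_inj); apply/eqP; rewrite eqEcard card_imset; last exact: perm_inj.
rewrite AB leqnn andbT.
apply/fintype.subsetP => _ /imsetP[x xA ->]; rewrite permE /f.
have ix : (index x (l A) < #|B|)%N.
  by rewrite index_cat mem_enum xA -AB cardE index_mem mem_enum.
by rewrite nth_cat -cardE ix -mem_enum mem_nth // -cardE.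
Qed.

Lemma card_permT : #|{perm T}| = (#|T|)`!.
Proof.
rewrite -[#|T|]cardsT -card_perm; apply: eq_card => s.
by rewrite [RHS]unfold_in; apply/esym/fintype.subsetP => x; rewrite finset.in_setT.
Qed.

(** For each [K'] of the size of [J] and [K], pick [r K'] taking [K] to [K']. The product [s * r K']
    sends [J] to [K'], so it determines [K'] and then [s]: all these permutations are distinct. *)
Lemma card_perm_imset_le J K :
  (#|[set s : {perm T} | s @: J == K]%SET| * 'C(#|T|, #|J|) <= (#|T|)`!)%N.
Proof.
have [cJK|] := eqVneq #|J| #|K|; last first.
  move=> ne; rewrite (_ : [set _ | _]%SET = finset.set0) ?cards0 //.
  apply/setP => s; rewrite finset.in_set0 finset.in_set; apply: contraNF ne => /eqP <-.
  by rewrite card_imset //; exact: perm_inj.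
pose D := [set K' : {set T} | #|K'| == #|J|]%SET.
have /boolp.choice[r rP] : forall K' : {set T}, exists s : {perm T},
    K' \in D -> s @: K = K'.
  move=> K'; have [|] := boolP (K' \in D); last by exists 1%g.
  rewrite finset.in_set cJK => /eqP e; have [s sK] := exists_perm_imset (esym e).
  by exists s.
rewrite -card_draws -cardsX.
pose f (x : {perm T} * {set T}) := (x.1 * r x.2)%g.
have im (x : {perm T} * {set T}) :
    x \in finset.setX [set s : {perm T} | s @: J == K]%SET D ->
    f x @: J = x.2.
  case: x => s K' /=; rewrite finset.in_setX finset.in_set /= => /andP[/eqP sJ K'D].
  rewrite -[RHS](rP K') // -sJ -imset_comp; apply: eq_imset => x /=.
  by rewrite permM.
have f_inj : {in finset.setX [set s : {perm T} | s @: J == K]%SET D &, injective f}.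
  move=> x y xD yD fxy; have e2 : x.2 = y.2 by rewrite -(im x) // -(im y) // fxy.
  move: fxy; rewrite /f e2 => /mulIg e1.
  by case: x y e1 e2 {xD yD} => ? ? [? ?] /= -> ->.
by rewrite -(card_in_imset f_inj) -card_permT max_card.
Qed.

(** Choosing one [a] per permutation splits all permutations into [#|A|] classes; within a class
    some [J] of size [h] has a fixed image, which bounds the class. *)
Lemma bin_le_card_cover (A : finType) (P : {perm T} -> A -> Prop) h :
  (forall s, exists a, P s a) ->
  (forall s0 a, P s0 a -> exists2 J : {set T},
      #|J| = h & forall s, P s a -> s @: J = s0 @: J) ->
  ('C(#|T|, h) <= #|A|)%N.
Proof.
move=> /boolp.choice[g gP] cov.
have part : #|{perm T}| = (\sum_a #|[set s | g s == a]%SET|)%N.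
  rewrite -sum1_card (partition_big g predT) //=.
  by apply: eq_bigr => a _; rewrite sum1dep_card.
rewrite -(leq_pmul2r (fact_gt0 #|T|)) mulnC -{1}card_permT part.
rewrite big_distrl /= -sum_nat_const; apply: leq_sum => a _.
have [->|[s0]] := set_0Vmem [set s | g s == a]%SET; first by rewrite cards0 mul0n.
rewrite finset.in_set => /eqP ga; have [J cJ JP] := cov s0 a (eq_ind _ _ (gP s0) _ ga).
rewrite -cJ; apply: leq_trans (card_perm_imset_le J (s0 @: J)).
rewrite leq_mul2r subset_leq_card ?orbT //; apply/fintype.subsetP => s.
rewrite !finset.in_set => /eqP gs; apply/eqP/JP; rewrite -gs; exact: gP.
Qed.

Lemma exp2_le_card_cover (A : finType) (P : nat -> {perm T} -> A -> Prop) :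
  (forall h s, (h <= #|T|)%N -> exists a, P h s a) ->
  (forall h s0 a, P h s0 a -> exists2 J : {set T},
      #|J| = h & forall s, P h s a -> s @: J = s0 @: J) ->
  (2 ^ #|T| <= (#|T|).+1 * #|A|)%N.
Proof.
move=> ex cov; rewrite -[2%N]/(1 + 1)%N expnDn.
rewrite -[X in (X * _)%N]card_ord -sum_nat_const; apply: leq_sum => h _.
rewrite !exp1n !muln1; apply: bin_le_card_cover (cov h) => s.
by apply: ex; rewrite -ltnS.
Qed.

End PermCounting.

(** * Hamiltonian cycles of the complete graph from cyclic orders *)

Section CyclicTours.
Variable n : nat.
Hypothesis n_gt2 : (2 < n)%N.
Implicit Types (i j k : 'I_n) (f : 'I_n -> 'I_n).

Lemma ordS_neq i : ordS i != i.
Proof.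
rewrite -val_eqE /=; have := ltn_ord i.
rewrite leq_eqVlt => /orP[/eqP e|lt]; first by rewrite {1}e modnn; lia.
by rewrite modn_small //; lia.
Qed.

Lemma ordS2_neq i : ordS (ordS i) != i.
Proof.
rewrite -val_eqE /=; have := ltn_ord i.
rewrite leq_eqVlt => /orP[/eqP e|lt].
  by rewrite {1}e modnn modn_small; lia.
rewrite (modn_small lt) -[X in _ != X](modn_small (ltn_ord i)).
move: lt; rewrite leq_eqVlt => /orP[/eqP e|lt]; first by rewrite {1}e modnn modn_small; lia.
by rewrite !modn_small //; lia.
Qed.

Definition cyclic_edges f : {set {set 'I_n}} :=
  [set [set f i; f (ordS i)]%SET | i : 'I_n]%SET.

Variable f : 'I_n -> 'I_n.
Hypothesis f_inj : injective f.

Lemma cyclic_edges_complete : cyclic_edges f \subset edges (complete_graph n).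
Proof.
apply/fintype.subsetP => _ /imsetP[i _ ->].
by rewrite inE cards2 (inj_eq f_inj) [_ == ordS _]eq_sym ordS_neq.
Qed.

Lemma cyclic_edges_setT (e : {set complete_graph n}) :
  e \in cyclic_edges f -> e \subset [set: complete_graph n]%SET.
Proof. by move=> _; exact: finset.subsetT. Qed.

Definition cyclic_subgraph : subgraph (complete_graph n) :=
  @Subgraph (complete_graph n) [set: complete_graph n]%SET
    (cyclic_edges f) cyclic_edges_complete cyclic_edges_setT.

Lemma cyclic_subgraph_hamiltonian : hamiltonian_cycle cyclic_subgraph.
Proof.
have surj v : exists i, v = f i by exists (invF f_inj v); rewrite f_invF.
split; last first.
  move=> v; have [i ->] := surj v.
  suff -> : [set e in cyclic_edges f | f i \in e]%SET =
      [set [set f (ord_pred i); f i]; [set f i; f (ordS i)]]%SET.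
    (* If the two edges coincided, the predecessor of [i] would be [i] or its successor; the latter
       is excluded by [n > 2]. *)
    rewrite cards2; case: eqVneq => // /setP/(_ (f (ord_pred i))).
    rewrite !finset.in_set2 eqxx !(inj_eq f_inj) /= => /esym/orP[/eqP e|/eqP e].
      by have := ordS_neq (ord_pred i); rewrite ord_predK e eqxx.
    by have := ordS2_neq (ord_pred i); rewrite ord_predK e eqxx.
  apply/setP => e; rewrite finset.in_set finset.in_set2; apply/andP/orP.
    move=> [/imsetP[j _ ->]]; rewrite finset.in_set2 !(inj_eq f_inj).
    move=> /orP[] /eqP ->; first by right.
    by left; rewrite ordSK.
  move=> [] /eqP ->; rewrite !finset.in_set2 eqxx ?orbT; split=> //.
    by apply/imsetP; exists (ord_pred i); rewrite ?ord_predK.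
  by apply/imsetP; exists i.
have n0 : (0 < n)%N by apply: leq_trans n_gt2.
pose o := Ordinal n0.
split; first by exists o; rewrite finset.in_setT.
set r := [rel u v | _].
have sr : connect_sym r.
  apply: sym_connect_sym => u v /=; rewrite finset.setUC //.
have base k : connect r (f o) (f k).
  case: k => k; elim: k => [|k IH] kn; first
    by rewrite (_ : Ordinal kn = o) //; exact: val_inj.
  apply: connect_trans (IH (ltnW kn)) (connect1 _).
  apply/imsetP; exists (Ordinal (ltnW kn)) => //; congr [set _; f _]%SET.
  by apply/val_inj; rewrite /= modn_small.
move=> x y _ _; have [[i ->] [j ->]] := (surj x, surj y).
by apply: connect_trans (base j); rewrite sr.
Qed.

End CyclicTours.

(** * Embedding the permutation tours in the complete graph *)

Section Layout.
Variables (m n : nat).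
Hypothesis mn : (3 * m <= n)%N.

(* Slots 3i, 3i+1, 3i+2 of the base cycle hold the left side, the item and the
   right side of position i; a permutation rearranges only the items. *)
Lemma slot_subproof (d : 'I_3) (i : 'I_m) : (3 * i + d < n)%N.
Proof. have := ltn_ord i; have := ltn_ord d; lia. Qed.

Definition slot d i : 'I_n := Ordinal (slot_subproof d i).
Definition item : 'I_m -> 'I_n := slot 1.
Definition side (b : bool) : 'I_m -> 'I_n := slot (if b then 0 else 2).

Lemma slot_inj d d' i i' : slot d i = slot d' i' -> d = d' /\ i = i'.
Proof.
move=> /(congr1 val) /= e; have := ltn_ord d; have := ltn_ord d' => l l'.
by split; apply: val_inj => /=; lia.
Qed.

Lemma item_inj : injective item.
Proof. by move=> i j /slot_inj[]. Qed.

Lemma side_inj b b' i i' : side b i = side b' i' -> i = i'.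
Proof. by move=> /slot_inj[]. Qed.

Lemma side_item b i j : side b i != item j.
Proof. by apply/eqP => /slot_inj[]; case: b. Qed.

Lemma ordS_left i : ordS (side true i) = item i.
Proof.
apply: val_inj; rewrite /= modn_small ?addn0 ?addn1 //.
by have := ltn_ord i; lia.
Qed.

Lemma ordS_item i : ordS (item i) = side false i.
Proof.
apply: val_inj; rewrite /= modn_small ?addn1 ?addn2 //.
by have := ltn_ord i; lia.
Qed.

Definition arrange (tau : {perm 'I_m}) (k : 'I_n) : 'I_n :=
  if [pick i | item i == k] is Some i then item (tau i) else k.

Lemma arrange_item tau i : arrange tau (item i) = item (tau i).
Proof.
rewrite /arrange; case: pickP => [j /eqP/item_inj-> //|/(_ i)].
by rewrite eqxx.
Qed.

Lemma arrange_id tau k : (forall i, item i != k) -> arrange tau k = k.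
Proof. by rewrite /arrange; case: pickP => [i /eqP <- /(_ i)|//]; rewrite eqxx. Qed.

Lemma itemP k : (exists i, k = item i) \/ (forall i, item i != k).
Proof.
have [/existsP[i /eqP e]|] := boolP [exists i, item i == k]; first by left; exists i.
by rewrite negb_exists => /forallP; right.
Qed.

Lemma arrange_inj tau : injective (arrange tau).
Proof.
move=> j k; case: (itemP j) => [[i ->]|nj]; case: (itemP k) => [[i' ->]|nk];
  rewrite ?arrange_item ?(arrange_id tau nj) ?(arrange_id tau nk) //.
- by move=> /item_inj/perm_inj->.
- by move=> e; have := nk (tau i); rewrite e eqxx.
- by move=> e; have := nj (tau i'); rewrite e eqxx.
Qed.

Notation Kedge := (edge (complete_graph n)).

Lemma join_subproof b i j : [set side b i; item j]%SET \in edges (complete_graph n).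
Proof. by rewrite inE cards2 side_item. Qed.

Definition join b i j : Kedge :=
  exist (fun e : {set complete_graph n} => e \in edges (complete_graph n)) _
    (join_subproof b i j).

Definition incident (u : 'I_n) : pred Kedge := fun e => u \in val e.

Lemma incident_join u b i j :
  incident u (join b i j) = (u == side b i) || (u == item j).
Proof. exact: finset.in_set2. Qed.

Definition frame : pred Kedge := fun e =>
  [exists k, [&& [forall i, item i != k], [forall i, item i != ordS k]
                & val e == [set k; ordS k]%SET]].

Lemma join_frame b i j : ~~ frame (join b i j).
Proof.
apply/existsP => -[k /and3P[/forallP/(_ j) nk /forallP/(_ j) nSk]].
move=> /eqP/setP/(_ (item j)).
by rewrite !finset.in_set2 eqxx orbT (negbTE nk) (negbTE nSk).
Qed.

(** Item slots are never adjacent, so a step of the base cycle goes from an item to its right side,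
    from a left side to its item, or avoids items. The first two kinds become joins, the third is
    the frame. *)
Lemma mem_cyclic_arrange tau (e : Kedge) :
  (val e \in cyclic_edges (arrange tau)) = tour frame join tau e.
Proof.
apply/imsetP/orP => [[k _ eE]|[/existsP[k]|/existsP[b /existsP[i /eqP->]]]].
- have [[i kE]|nk] := itemP k.
    right; apply/existsP; exists false; apply/existsP; exists i; apply/eqP/val_inj.
    rewrite eE kE ordS_item arrange_item arrange_id 1?finset.setUC // => j.
    by rewrite eq_sym side_item.
  have [[i SkE]|nSk] := itemP (ordS k).
    right; apply/existsP; exists true; apply/existsP; exists i; apply/eqP/val_inj.
    have kE : k = side true i by apply: (@ordS_inj n); rewrite ordS_left.
    by rewrite eE SkE arrange_item arrange_id // kE.
  left; apply/existsP; exists k; rewrite eE !arrange_id // eqxx andbT.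
  by apply/andP; split; apply/forallP.
- move=> /and3P[/forallP nk /forallP nSk /eqP eE].
  by exists k; rewrite ?arrange_id.
- exists (if b then side true i else item i) => //; case: b.
    rewrite ordS_left arrange_item arrange_id //= => j; by rewrite eq_sym side_item.
  rewrite ordS_item arrange_item arrange_id; first exact: finset.setUC.
  by move=> j; rewrite eq_sym side_item.
Qed.

End Layout.

(** * Peeling a walk off a flow *)

Section Flows.
Variables (R : realType) (N : network).
Local Notation s := (source N).
Local Notation t := (sink N).
Implicit Types (phi psi : {ffun net_arc N -> R}) (v : net_node N).
Implicit Types (p q : seq (net_arc N)).

Definition unit_flow (a : net_arc N) : {ffun net_arc N -> R} :=
  [ffun b => (b == a)%:R].

Definition walk_flow p : {ffun net_arc N -> R} := \sum_(a <- p) unit_flow a.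

Lemma excessD phi psi v : excess (phi + psi) v = excess phi v + excess psi v.
Proof.
rewrite /excess /flow_on; under eq_bigr do rewrite ffunE.
under [in X in _ - X]eq_bigr do rewrite ffunE.
by rewrite !big_split /= opprD addrACA.
Qed.

Lemma excessZ k phi v : excess (k *: phi) v = k * excess phi v.
Proof.
rewrite /excess /flow_on mulrBr !mulr_sumr.
by congr (_ - _); apply: eq_bigr => a _; rewrite ffunE.
Qed.

Lemma excess0 v : excess (0 : {ffun net_arc N -> R}) v = 0.
Proof. by rewrite /excess /flow_on !big1 ?subr0 // => a _; rewrite ffunE. Qed.

Lemma excess_unit_flow a v :
  excess (unit_flow a) v = (arc_tail a == v)%:R - (arc_head a == v)%:R.
Proof.
have sumE (B : {set net_arc N}) : \sum_(b in B) unit_flow a b = (a \in B)%:R :> R.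
  under eq_bigr do rewrite ffunE.
  rewrite big_mkcond (bigD1 a) //= eqxx big1 ?addr0; first by case: ifP.
  by move=> b /negbTE->; case: ifP.
by rewrite /excess /flow_on !sumE !finset.in_set.
Qed.

Lemma excess_walk_flow x p y v : walk x p y ->
  excess (walk_flow p) v = (x == v)%:R - (y == v)%:R.
Proof.
rewrite /walk_flow; elim: p x => [x /eqP->|a p IH x /= /andP[/eqP<- /IH e]].
  by rewrite big_nil excess0 subrr.
by rewrite big_cons excessD excess_unit_flow e addrA subrK.
Qed.

Lemma walk_flow_ge0 p a : 0 <= walk_flow p a.
Proof. by rewrite sum_ffunE sumr_ge0 // => b _; rewrite ffunE. Qed.

Lemma walk_flow_notin p a : a \notin p -> walk_flow p a = 0.
Proof.
move=> ap; rewrite sum_ffunE big_seq big1 // => b bp; rewrite ffunE.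
by case: eqP ap => // ->; rewrite bp.
Qed.

Lemma walk_flow_le_size p a : walk_flow p a <= (size p)%:R.
Proof.
rewrite sum_ffunE -sum1_size natr_sum; apply: ler_sum => b _.
by rewrite ffunE ler_nat leq_b1.
Qed.

Lemma walk_flow_polyhedron k p : 0 <= k -> walk s p t ->
  flow_polyhedron N k (k *: walk_flow p).
Proof.
move=> k0 wp; split=> [v vs vt||a].
- rewrite excessZ (excess_walk_flow _ wp) eq_sym (negbTE vs).
  by rewrite eq_sym (negbTE vt) subrr mulr0.
- rewrite excessZ (excess_walk_flow _ wp) eqxx.
  by rewrite (negbTE (sink_neq_source N)) subr0 mulr1.
- by rewrite ffunE mulr_ge0 // walk_flow_ge0.
Qed.

Lemma sum_excess phi (X : {set net_node N}) :
  \sum_(v in X) excess phi v =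
  \sum_a phi a * ((arc_tail a \in X)%:R - (arc_head a \in X)%:R).
Proof.
have side (g : net_arc N -> net_node N) :
    \sum_(v in X) \sum_(a | g a == v) phi a = \sum_a phi a * (g a \in X)%:R.
  rewrite (exchange_big_dep predT) //=; apply: eq_bigr => a _.
  have [gX|gX] := boolP (g a \in X).
    rewrite (bigD1 (g a)) ?gX ?eqxx //= big1 ?addr0 ?mulr1 //.
    by move=> v /andP[/andP[_ /eqP->]]; rewrite eqxx.
  rewrite big1 ?mulr0 // => v /andP[vX /eqP gv]; by rewrite gv vX in gX.
under eq_bigr => v _.
  rewrite (_ : excess phi v =
    \sum_(a | arc_tail a == v) phi a - \sum_(a | arc_head a == v) phi a); last first.
    by congr (_ - _); apply: eq_bigl => a; rewrite finset.in_set.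
  over.
rewrite sumrB !side -sumrB.
by apply: eq_bigr => a _; rewrite mulrBr.
Qed.

(** Let [X] be the set reachable from the source along arcs of positive flow. Were the sink outside,
    the total excess of [X] would be [k > 0], yet no positive flow leaves [X]. *)
Lemma supported_walk k phi : 0 < k -> flow_polyhedron N k phi ->
  exists2 p, walk s p t & forall a, a \in p -> 0 < phi a.
Proof.
move=> k0 [phi0 phik phi_ge0].
pose r := [rel x y | [exists a, [&& 0 < phi a, arc_tail a == x & arc_head a == y]]].
have [/connectP[p]|nt] := boolP (connect r s t).
  elim: p s => [x _ /= ->|y p IH x /= /andP[/existsP[a] + pp] e].
    by exists [::]; rewrite /= ?eqxx.
  move=> /and3P[pa /eqP<- /eqP ay]; rewrite -ay in pp e *.
  have [q wq posq] := IH _ pp e; exists (a :: q); rewrite /= ?eqxx //.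
  by move=> b; rewrite in_cons => /orP[/eqP->|/posq].
pose X := [set v | connect r s v]%SET.
have : \sum_(v in X) excess phi v = k.
  rewrite (bigD1 s) ?finset.in_set ?connect0 //= phik big1 ?addr0 //.
  move=> v /andP[vX vs]; apply: phi0 => //; apply: contraNneq nt => <-.
  by move: vX; rewrite finset.in_set.
rewrite sum_excess => e; exfalso; move: k0; rewrite -e ltNge => /negP[].
apply: sumr_le0 => a _.
have [->|ne] := eqVneq (phi a) 0; first by rewrite mul0r.
have pa : 0 < phi a by rewrite lt_neqAle eq_sym ne phi_ge0.
rewrite pmulr_rle0 // subr_le0 ler_nat !finset.in_set.
case: (boolP (connect r s _)) => // ct.
suff -> : connect r s (arc_head a) by [].
by apply: connect_trans ct (connect1 _); apply/existsP; exists a; rewrite pa !eqxx.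
Qed.

Lemma positive_lower_bound (T : eqType) (g : T -> R) (l : seq T) :
  (forall x, x \in l -> 0 < g x) ->
  exists2 d, 0 < d & forall x, x \in l -> d <= g x.
Proof.
elim: l => [_|x l IH gl]; first by exists 1.
have [|d d0 dl] := IH; first by move=> y yl; apply: gl; rewrite in_cons yl orbT.
exists (Num.min d (g x)); first by rewrite lt_min d0 gl ?mem_head.
move=> y; rewrite in_cons ge_min => /orP[/eqP->|/dl->//].
by rewrite lexx orbT.
Qed.

Lemma flow_peel_walk k phi : 0 < k -> flow_polyhedron N k phi ->
  exists p, walk s p t /\ exists eps psi, [/\ 0 < eps < 1,
    flow_polyhedron N k psi &
    phi = eps *: (k *: walk_flow p) + (1 - eps) *: psi].
Proof.
move=> k0 Qphi; have [p wp pos] := supported_walk k0 Qphi.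
exists p; split=> //.
have [d d0 dle] := positive_lower_bound pos.
(* The walk may repeat an arc, at most [size p] times, so [K] bounds [k] times its flow on any arc;
   the successor makes [K] visibly positive. *)
pose K := k * (size p).+1%:R.
have K0 : 0 < K by rewrite mulr_gt0.
(* [1 / 2] keeps [1 - eps] invertible, and [d / K] keeps the remaining flow nonnegative. *)
pose eps := Num.min (1 / 2) (d / K).
have eps0 : 0 < eps by rewrite lt_min divr_gt0 // divr_gt0.
have eps1 : eps < 1 by rewrite gt_min ltr_pdivrMr // mul1r ltr1n.
have u1 : 1 - eps != 0 by rewrite gt_eqF // subr_gt0.
have epsK : eps * K <= d by rewrite -ler_pdivlMr // ge_min lexx orbT.
pose psi := (1 - eps)^-1 *: (phi - eps *: (k *: walk_flow p)).
exists eps, psi; split; first by rewrite eps0.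
- have [phi0 phik phi_ge0] := Qphi.
  have [w0 wk w_ge0] := walk_flow_polyhedron (ltW k0) wp.
  have exc v : excess psi v =
      (1 - eps)^-1 * (excess phi v - eps * excess (k *: walk_flow p) v).
    rewrite /psi excessZ; congr (_ * _).
    by rewrite -scaleN1r excessD !excessZ mulN1r.
  split=> [v vs vt||a]; rewrite ?exc.
  + by rewrite phi0 // w0 // mulr0 subr0 mulr0.
  + by rewrite phik wk -{1}[k]mul1r -mulrBl mulrA mulVf // mul1r.
  + rewrite /psi !ffunE; apply: mulr_ge0; first by rewrite invr_ge0 subr_ge0 ltW.
    rewrite subr_ge0 -[leLHS]/(eps * (k * walk_flow p a)).
    have [ap|ap] := boolP (a \in p); last by rewrite walk_flow_notin // !mulr0.
    apply: le_trans (dle a ap); apply: le_trans epsK.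
    rewrite /K ler_pM2l // ler_pM2l // (le_trans (walk_flow_le_size _ _)) //.
    by rewrite ler_nat.
- by rewrite /psi [X in _ + X]scalerA mulfV // scale1r addrC subrK.
Qed.

End Flows.

(** * Walk costs induced by a flow-based extension *)

Section Extensions.
Variables (R : realType) (N : network) (k : R) (E : finType).
Variable P : set {ffun E -> R}.
Variable f : {linear {ffun net_arc N -> R} -> {ffun E -> R}}.
Hypothesis k_gt0 : 0 < k.
Hypothesis fP : (f @` flow_polyhedron N k)%classic = P.
Hypothesis P01 : forall x e, P x -> 0 <= x e <= 1.

(** The factor [k] makes the cost of a source-sink walk the image of [k] units sent along it, hence
    a point of [P]. *)
Definition arc_cost (a : net_arc N) (e : E) : R := k * f (unit_flow R a) e.

Lemma cost_walk_flow p e : cost arc_cost p e = f (k *: walk_flow R p) e.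
Proof.
by rewrite linearZ ffunE /= /walk_flow linear_sum sum_ffunE scaler_sumr.
Qed.

Lemma walk_flow_image p : walk (source N) p (sink N) -> P (f (k *: walk_flow R p)).
Proof. by move=> wp; rewrite -fP; eexists; [exact: walk_flow_polyhedron (ltW k_gt0) wp|]. Qed.

(* A 0/1 point of [P] is extreme in the unit cube, so peeling a small multiple
   of a walk off a preimage leaves that walk with the same image. *)
Lemma zero_one_point_walk (x : {ffun E -> R}) (H : pred E) :
  P x -> (forall e, x e = (H e)%:R) ->
  exists2 p, walk (source N) p (sink N) & forall e, cost arc_cost p e = (H e)%:R.
Proof.
move=> Px xH; have [phi Qphi phix] : (f @` flow_polyhedron N k)%classic x by rewrite fP.
have [p [wp [eps [psi [/andP[e0 e1] Qpsi phiE]]]]] := flow_peel_walk k_gt0 Qphi.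
exists p => // e; rewrite cost_walk_flow -xH.
have /andP[w0 w1] := P01 e (walk_flow_image wp).
have Pps : P (f psi) by rewrite -fP; exists psi.
have /andP[p0 p1] := P01 e Pps.
have : x e = eps * f (k *: walk_flow R p) e + (1 - eps) * f psi e.
  have fZ a u : f (a *: u) e = a * f u e by rewrite linearZ ffunE.
  by rewrite -phix phiE linearD ffunE !fZ.
move: w0 w1 p0 p1; rewrite xH; set w := f _ e; set y := f _ e.
case: (H e) => /=; nra.
Qed.

End Extensions.

(** * Valid constraints of the traveling salesman polytope *)

Section TspPolytope.
Variables (R : realType) (G : sgraph).

(** Box bounds and degree equations cut out a convex set containing every cycle vector, hence the
    hull. *)
Lemma tsp_polytope_bounds (x : {ffun edge G -> R}) : tsp_polytope R G x ->
  (forall e, 0 <= x e <= 1) /\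
  (forall u : G, \sum_(e : edge G | u \in val e) x e = 2).
Proof.
pose A := [set x : {ffun edge G -> R} | (forall e, 0 <= x e <= 1) /\
  (forall u : G, \sum_(e : edge G | u \in val e) x e = 2)]%classic.
suff /(_ x) : (tsp_polytope R G `<=` A)%classic by [].
apply: smallest_sub.
  move=> y z l; rewrite !classical_sets.inE => -[y01 y2] [z01 z2].
  have cE e : conv l y z e = l%:inum * y e + (1 - l%:inum) * z e.
    by rewrite !ffunE.
  have l0 : 0 <= l%:inum by [].
  have l1 : l%:inum <= 1 by [].
  split=> [e|u].
    rewrite cE; have := y01 e; have := z01 e; nra.
  under eq_bigr do rewrite cE.
  rewrite big_split /= -!mulr_sumr y2 z2; ring.
move=> _ [C [[_ deg2] ->]]; split=> [e|u].
  by rewrite ffunE ler0n lern1 leq_b1.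
under eq_bigr do rewrite ffunE.
rewrite -natr_sum -(deg2 u); congr (_%:R).
rewrite -big_mkcondr sum1_card -(card_imset _ val_inj); apply: eq_card => e.
rewrite finset.in_set; apply/imsetP/andP => [[e' /andP[ue Ce] ->]//|[Ce ue]].
have eG := fintype.subsetP (sub_edges_sub C) e Ce.
by exists (exist (fun e : {set G} => e \in edges G) e eG); rewrite //= unfold_in /= ue.
Qed.

Lemma tsp_polytope_incidence (C : subgraph G) :
  hamiltonian_cycle C -> tsp_polytope R G (edge_incidence R (sub_edges C)).
Proof. by move=> hC A [_ XA]; apply: XA; exists C. Qed.

End TspPolytope.

(** * The size bound and its asymptotic form *)

Lemma tsp_extension_size (R : realType) (n m : nat) (N : network) (k : R) :
  (3 * m <= n)%N -> (1 < m)%N ->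
  flow_based_extension N k (tsp_polytope R (complete_graph n)) ->
  (2 ^ m <= m.+1 * net_size N)%N.
Proof.
move=> mn m1 [k0 [f fP]]; have n2 : (2 < n)%N by lia.
have P01 x e : tsp_polytope R (complete_graph n) x -> 0 <= x e <= 1.
  by case/tsp_polytope_bounds.
pose c := arc_cost k f.
have cost01 p e : walk (source N) p (sink N) -> 0 <= cost c p e <= 1.
  by move=> wp; rewrite cost_walk_flow; exact: (P01 _ e (walk_flow_image k0 fP wp)).
have cost_deg p u : walk (source N) p (sink N) ->
    \sum_(e | incident u e) cost c p e = 2.
  move=> wp; under eq_bigr do rewrite cost_walk_flow.
  by have [_ ->] := tsp_polytope_bounds (walk_flow_image k0 fP wp).
have tour_walk (tau : {perm 'I_m}) : exists2 p, walk (source N) p (sink N) &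
    forall e, cost c p e = (tour (frame mn) (join mn) tau e)%:R.
  have hC := cyclic_subgraph_hamiltonian n2 (@arrange_inj _ _ mn tau).
  apply: (zero_one_point_walk k0 fP P01 (tsp_polytope_incidence hC)) => e.
  by rewrite ffunE /= mem_cyclic_arrange.
have := @exp2_le_card_cover 'I_m (net_arc N)
  (splits c (@incident n) (frame mn) (side mn) (join mn)).
rewrite card_ord; apply.
  move=> h tau hm.
  exact: (splits_exists cost01 cost_deg (@side_inj _ _ mn) (@item_inj _ _ mn)
    (@side_item _ _ mn) (@incident_join _ _ mn) (@join_frame _ _ mn) tour_walk).
move=> h tau a.
exact: (splits_imset cost01 cost_deg (@side_inj _ _ mn) (@item_inj _ _ mn)
    (@side_item _ _ mn) (@incident_join _ _ mn) (@join_frame _ _ mn)).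
Qed.

(** With [q = n %/ 12] the hypothesis gives 16^q <= n N. Split 16^q as 8^q 2^q: the first factor is
    at least 2^(n/4) / 8, and the second at least sqrt(n) / 12, which cancels one of the two roots
    in n. The constant is 96 = 8 * 12. *)
Lemma exp2_quarter_le (R : realType) (n N : nat) : (24 <= n)%N ->
  (2 ^ (4 * (n %/ 12)) <= (4 * (n %/ 12)).+1 * N)%N ->
  96^-1 * (2 `^ (n%:R / 4) / Num.sqrt n%:R) <= N%:R :> R.
Proof.
move=> n24; set q := (n %/ 12)%N => qN.
have n12 : (12 * q <= n < 12 * q.+1)%N.
  by have := divn_eq n 12; have := ltn_pmod n (isT : 0 < 12)%N; rewrite -/q; lia.
have s0 : 0 < Num.sqrt n%:R :> R by rewrite sqrtr_gt0 ltr0n; lia.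
have ss : Num.sqrt n%:R * Num.sqrt n%:R = n%:R :> R by rewrite -expr2 sqr_sqrtr.
have pw : 2 `^ (n%:R / 4) <= 8 * 8 ^+ q :> R.
  have -> : 8 * 8 ^+ q = 2 `^ (3 * q.+1)%:R :> R.
    rewrite powR_mulrn // exprM -exprS; congr (_ ^+ _); rewrite !exprS expr0; ring.
  apply: ler_powR; first by rewrite ler1n.
  rewrite ler_pdivrMr // -natrM ler_nat; lia.
have y_ge : (q.+1)%:R <= 2 ^+ q :> R by rewrite -natrX ler_nat ltn_expl.
have y0 : 0 < 2 ^+ q :> R by apply: exprn_gt0.
have S_le : Num.sqrt n%:R <= 12 * 2 ^+ q :> R.
  have s1 : 1 <= Num.sqrt n%:R :> R.
    by rewrite -[leLHS]sqrtr1 ler_wsqrtr // ler1n; lia.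
  have : n%:R <= 12 * (q.+1)%:R :> R by rewrite -natrM ler_nat; lia.
  rewrite -{1}ss; nra.
have xy : 8 ^+ q * 2 ^+ q <= Num.sqrt n%:R * Num.sqrt n%:R * N%:R :> R.
  rewrite ss -exprMn -!natrM -natrX ler_nat -[(8 * 2)%N]/(2 ^ 4)%N -expnM.
  by apply: leq_trans qN _; rewrite leq_mul2r; apply/orP; right; lia.
rewrite mulrA ler_pdivrMr // ler_pdivrMl //; apply: le_trans pw _.
suff : 8 ^+ q <= 12 * (Num.sqrt n%:R * N%:R) :> R by lra.
rewrite -(ler_pM2r y0); apply: le_trans xy _.
have N0 : 0 <= N%:R :> R by [].
have SN0 : 0 <= Num.sqrt n%:R * N%:R :> R by rewrite mulr_ge0 // ltW.
have := ler_wpM2r SN0 S_le; lra.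
Qed.

Theorem theorem8 (R : realType) :
  exists2 C : R, 0 < C &
  exists n0 : nat, forall n : nat, (n0 <= n)%N ->
    (forall (N : network) (k : R),
       flow_based_extension N k (tsp_polytope R (complete_graph n)) ->
       C * (2 `^ (n%:R / 4) / Num.sqrt n%:R) <= (net_size N)%:R) /\
    (forall N : network,
       st_path_extension N (tsp_polytope R (complete_graph n)) ->
       C * (2 `^ (n%:R / 4) / Num.sqrt n%:R) <= (net_size N)%:R).
Proof.
exists 96^-1; first by rewrite invr_gt0.
(* From 24 on, the number [4 * (n %/ 12)] of items exceeds 1, as [tsp_extension_size] requires. *)
exists 24%N => n n24.
have bound (N : network) (k : R) :
    flow_based_extension N k (tsp_polytope R (complete_graph n)) ->
    96^-1 * (2 `^ (n%:R / 4) / Num.sqrt n%:R) <= (net_size N)%:R.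
  move=> ext; apply: exp2_quarter_le => //.
  apply: tsp_extension_size ext; lia.
split=> [N k|N [_ ext]]; [exact: bound|exact: bound ext].
Qed.
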